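(* Let $k\ge 3$ and $2\le m\le k-1$ be integers, and put $t=k-m+1$. Then for every integer $w\ge t+1$, $$\psi(w,k,m)\ \ge\ (k-1)\,\psi(w-1,k,m)+\left\lfloor\frac{k-1}{t}\right\rfloor f(w-t,k).$$
   Context: All set families are finite families of distinct sets. A family is $w$-uniform if all its members have exactly $w$ elements (the ground set is an arbitrary finite set, not fixed). A $k$-sunflower is a collection of $k$ distinct sets $A_1,\dots,A_k$ for which there is a set $C$ (the core, possibly empty) with $A_i\cap A_j=C$ for all $i\ne j$. The matching number $\nu(\mathcal F)$ is the largest number of pairwise disjoint members of $\mathcal F$. For $w\ge1$, $k\ge2$, $f(w,k)$ denotes the maximum size of a $w$-uniform family containing no $k$-sunflower (finite by the Erdős–Rado sunflower lemma). For $m\ge2$, $\psi(w,k,m)$ denotes the maximum size of a $w$-uniform family $\mathcal F$ containing no $k$-sunflower and satisfying $\nu(\mathcal F)\le m-1$. *)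

(* Defs.v *)
From mathcomp Require Import all_boot.
From mathcomp Require boolp classical_sets.

Set Implicit Arguments.
Unset Strict Implicit.
Unset Printing Implicit Defensive.

Section Families.

Variable T : finType.
Implicit Types (F S : {set {set T}}) (A B C : {set T}).

Definition uniform (w : nat) F : Prop := forall A, A \in F -> #|A| = w.

Definition is_sunflower (k : nat) S : Prop :=
  #|S| = k /\
  exists C, forall A B, A \in S -> B \in S -> A != B -> A :&: B = C.

Definition sunflower_free (k : nat) F : Prop :=
  forall S, S \subset F -> ~ is_sunflower k S.

Definition matching_number F : nat :=
  \max_(S : {set {set T}} | (S \subset F) && trivIset S) #|S|.

End Families.

(* The value is 0 when P has no largest element; by f_spec and psi_spec this
   never happens for the predicates used below when k >= 2. *)
Definition maximum (P : nat -> Prop) : nat :=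
  classical_sets.xget 0 (fun n => P n /\ forall i, P i -> i <= n).

(* The ground set is not fixed: sizes are collected over all finite types. *)
Definition f_size (w k n : nat) : Prop :=
  exists (T : finType) (F : {set {set T}}),
    [/\ uniform w F, sunflower_free k F & #|F| = n].

Definition f (w k : nat) : nat := maximum (f_size w k).

Definition psi_size (w k m n : nat) : Prop :=
  exists (T : finType) (F : {set {set T}}),
    [/\ uniform w F, sunflower_free k F, matching_number F <= m - 1
      & #|F| = n].

Definition psi (w k m : nat) : nat := maximum (psi_size w k m).

Lemma maximumP (P : nat -> Prop) (b : nat) :
  (exists n, P n) -> (forall n, P n -> n <= b) ->
  P (maximum P) /\ forall n, P n -> n <= maximum P.
Proof.
move=> [n0 Pn0] ub.
have exP : exists n, boolp.asbool (P n) by exists n0; apply/boolp.asboolP.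
have ubP n : boolp.asbool (P n) -> n <= b by move/boolp.asboolP/ub.
case: (ex_maxnP exP ubP) => n /boolp.asboolP Pn maxn.
rewrite /maximum.
have := @classical_sets.xgetPex _ 0 (fun n => P n /\ forall i, P i -> i <= n).
apply; exists n; split=> // i Pi; exact/maxn/boolp.asboolP.
Qed.

(* Erdos-Rado sunflower lemma *)
Lemma sunflower_bound (T : finType) (k w : nat) (F : {set {set T}}) :
  2 <= k -> uniform w F -> sunflower_free k F -> #|F| <= w`! * k.-1 ^ w.
Proof.
move=> k2; elim: w F => [|w IHw] F Fw Fk.
  rewrite fact0 mul1n expn0 -(cards1 (set0 : {set T})); apply: subset_leq_card.
  by apply/subsetP=> A /Fw /eqP; rewrite cards_eq0 inE.
have P0 : (set0 \subset F) && trivIset (set0 : {set {set T}}).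
  by rewrite sub0set; apply/trivIsetP=> A B; rewrite in_set0.
case: (@arg_maxnP _ set0 (fun S => (S \subset F) && trivIset S)
  (fun S => #|S|) P0) => S /andP[SF tS] Smax.
have Sk : #|S| <= k.-1.
  rewrite leqNgt; apply/negP; rewrite prednK ?(ltnW k2) // => kS.
  have [S' [uS' cS' sS']] := card_geqP kS.
  apply: (Fk [set A in S']).
    by apply/subsetP=> A; rewrite inE => /sS'; apply/subsetP.
  split; first by rewrite cardsE; move/card_uniqP: uS' => ->.
  exists set0 => A B; rewrite !inE => /sS' AS /sS' BS AB; apply/eqP.
  by rewrite setI_eq0; apply: (trivIsetP tS).
have cX : #|cover S| <= k.-1 * w.+1.
  rewrite -(eqP tS) (eq_bigr (fun=> w.+1)); last first.
    by move=> A AS; apply/Fw/(subsetP SF).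
  by rewrite sum_nat_const leq_mul2r Sk orbT.
pose D x := [set A in F | x \in A].
have Dbound x : #|D x| <= w`! * k.-1 ^ w.
  have inj : {in D x &, injective (fun A => A :\ x)}.
    move=> A B; rewrite !inE => /andP[_ xA] /andP[_ xB] eAB.
    by rewrite -(setD1K xA) eAB setD1K.
  rewrite -(card_in_imset inj); apply: IHw.
    move=> _ /imsetP[A + ->]; rewrite inE => /andP[/Fw Aw xA].
    by move: Aw; rewrite (cardsD1 x) xA add1n => -[].
  move=> S0 sS0 [cS0 [C S0C]].
  have S0D B : B \in S0 -> (x |: B \in F) && (x \notin B).
    move=> /(subsetP sS0) /imsetP[A]; rewrite inE => /andP[AF xA] ->.
    by rewrite setD1K // AF setD11.
  have inj0 : {in S0 &, injective (fun B => x |: B)}.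
    move=> A B /S0D/andP[_ xA] /S0D/andP[_ xB] eAB.
    by rewrite -(setU1K xA) eAB setU1K.
  apply: (Fk [set x |: B | B in S0]).
    by apply/subsetP=> _ /imsetP[B /S0D/andP[BF _] ->].
  split; first by rewrite card_in_imset.
  exists (x |: C) => _ _ /imsetP[A AS ->] /imsetP[B BS ->] AB.
  rewrite -setUIr (S0C A B) //; by apply: contraNneq AB => ->.
have sF : F \subset \bigcup_(x in cover S) D x.
  apply/subsetP=> A AF.
  have /set0Pn[x] : A :&: cover S != set0.
    apply/negP; rewrite setI_eq0 => dA.
    have AS : A \notin S.
      apply/negP=> AS.
      have /setIidPl eA : A \subset cover S by apply: (bigcup_sup A).
      by move: dA; rewrite -setI_eq0 eA -cards_eq0 (Fw A AF).
    suff /Smax : (A |: S \subset F) && trivIset (A |: S).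
      by rewrite /= cardsU1 AS add1n /geq /= ltnn.
    rewrite subUset sub1set AF SF; apply/trivIsetP=> B1 B2.
    have dS B : B \in S -> [disjoint A & B].
      by move=> BS; apply: disjointWr dA; apply: (bigcup_sup B).
    rewrite !inE => /predU1P[->|B1S] /predU1P[->|B2S] //; first by rewrite eqxx.
    - by move=> _; apply: dS.
    - by move=> _; rewrite disjoint_sym; apply: dS.
    - exact: (trivIsetP tS).
  rewrite inE => /andP[xA xS]; apply/bigcupP; exists x => //.
  by rewrite inE AF.
apply: leq_trans (subset_leq_card sF) _.
apply: leq_trans (_ : \sum_(x in cover S) #|D x| <= _).
  elim/big_rec2: _ => [|x n E _ le]; first by rewrite cards0.
  by rewrite (leq_trans (leq_card_setU _ _)) // leq_add2l.
apply: leq_trans (_ : \sum_(x in cover S) w`! * k.-1 ^ w <= _).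
  by apply: leq_sum => x _; apply: Dbound.
rewrite sum_nat_const factS expnS.
by rewrite mulnACA (mulnC w.+1) leq_mul2r cX orbT.
Qed.

Lemma sunflower_free0 (T : finType) (k : nat) :
  0 < k -> sunflower_free k (set0 : {set {set T}}).
Proof.
by move=> k0 S; rewrite subset0 => /eqP-> [/eqP]; rewrite cards0 eq_sym gtn_eqF.
Qed.

Lemma f_spec (w k : nat) : 2 <= k ->
  f_size w k (f w k) /\ forall n, f_size w k n -> n <= f w k.
Proof.
move=> k2; apply: (@maximumP _ (w`! * k.-1 ^ w)).
  exists 0, unit, set0; split; last exact: cards0.
    by move=> A; rewrite inE.
  exact/sunflower_free0/ltnW.
by move=> _ [T [F [Fw Fk <-]]]; apply: sunflower_bound.
Qed.

Lemma psi_spec (w k m : nat) : 2 <= k ->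
  psi_size w k m (psi w k m) /\
  forall n, psi_size w k m n -> n <= psi w k m.
Proof.
move=> k2; apply: (@maximumP _ (w`! * k.-1 ^ w)).
  exists 0, unit, set0; split; last exact: cards0.
  - by move=> A; rewrite inE.
  - exact/sunflower_free0/ltnW.
  - apply/bigmax_leqP=> S /andP[]; rewrite subset0 => /eqP-> _.
    by rewrite cards0.
by move=> _ [T [F [Fw Fk _ <-]]]; apply: sunflower_bound.
Qed.

(* Main.v *)
(** Let H be extremal for psi (w - 1) k m and E extremal for f (w - t) k, on
    disjoint ground sets, and let X be a set of k - 1 new points containing
    (k - 1) %/ t disjoint blocks of size t.  Take all sets x |: A with x in X
    and A in H (type 1), and all sets B :|: D with B a block and D in E
    (type 2).
    - In a matching the traces on X are disjoint.  If there is a set of type 2,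
      its trace has size t, so there are at most k - 1 - (t - 1) = m - 1 sets;
      otherwise the matching comes from a matching of H.
    - In a sunflower with k petals the traces on X cannot be disjoint, so the
      core meets X.  If all petals have the same type, their traces coincide
      and H or E contains a k-sunflower.  Otherwise exactly one petal has type
      2, and the k - 1 > m - 1 others give a matching of H. *)

Require Import Defs.
From mathcomp Require Import all_boot zify.

(** * Counting, matchings and preimages of sunflowers *)

(** Double counting: each point of [T] lies in at most one [F i]. *)
Lemma sum_card_disjoint {I T : finType} (S : {set I}) (F : I -> {set T}) :
  {in S &, forall i j, i != j -> [disjoint F i & F j]} ->
  \sum_(i in S) #|F i| <= #|T|.
Proof.
move=> dF; rewrite (eq_bigr (fun i => \sum_(x : T) (x \in F i : nat))); last first.
  by move=> i _; rewrite -sum1_card big_mkcond; apply: eq_bigr => x _; case: ifP.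
rewrite exchange_big -sum1_card; apply: leq_sum => x _ /=.
have [/existsP[i /andP[iS xi]]|] := boolP [exists i in S, x \in F i]; last first.
  rewrite negb_exists_in => /forall_inP nx.
  by rewrite big1 // => i /nx /negbTE ->.
rewrite (bigD1 i) //= xi big1 // => j /andP[jS ji].
by rewrite (disjointFl (dF _ _ jS iS ji) xi).
Qed.

Lemma card_matching {T : finType} (F S : {set {set T}}) :
  S \subset F -> trivIset S -> #|S| <= matching_number F.
Proof.
move=> SF tS.
by apply: (leq_bigmax_cond (F := fun S : {set {set T}} => #|S|)); rewrite SF.
Qed.

Lemma trivIset_preim {I T : finType} (g : I -> T) (S : {set {set T}}) (C : {set T}) :
  {in S &, forall A B, A != B -> A :&: B = C} -> g @^-1: C = set0 ->
  trivIset [set g @^-1: A | A : {set T} in S].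
Proof.
move=> sS C0; apply/trivIsetP => _ _ /imsetP[A AS ->] /imsetP[B BS ->] nAB.
rewrite -setI_eq0 -preimsetI (sS A B) ?C0 //.
by apply: contraNneq nAB => ->.
Qed.

(** Preimages commute with intersection, so the core pulls back; injectivity on [S] keeps the [k]
    petals distinct. *)
Lemma sunflower_preim {I T : finType} (g : I -> T) (k : nat) (S : {set {set T}}) :
  {in S &, injective (fun A : {set T} => g @^-1: A)} -> is_sunflower k S ->
  is_sunflower k [set g @^-1: A | A : {set T} in S].
Proof.
move=> gS [cS [C SC]]; split; first by rewrite card_in_imset.
exists (g @^-1: C) => _ _ /imsetP[A AS ->] /imsetP[B BS ->] AB.
by rewrite -preimsetI (SC A B) //; apply: contraNneq AB => ->.
Qed.

(** Block [j] is the interval from [j * t] to [j * t + t - 1]; division by [t] recovers [j] from any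
    of its points. *)
Lemma disjoint_blocks (q t n : nat) : q * t <= n ->
  exists B : 'I_q -> {set 'I_n},
    (forall j, #|B j| = t) /\ (forall i j x, x \in B i -> x \in B j -> i = j).
Proof.
move=> qtn.
have bnd (j : 'I_q) (i : 'I_t) : j * t + i < n.
  apply: leq_trans qtn; have := leq_mul2r t j.+1 q; rewrite ltn_ord orbT mulSn.
  by have := ltn_ord i; lia.
exists (fun j => [set Ordinal (bnd j i) | i : 'I_t]); split=> [j|j j' x].
  by rewrite card_imset ?card_ord // => i i' [] /addnI /ord_inj.
case/imsetP=> i _ -> /imsetP[i' _] [e]; apply/ord_inj.
have t0 : 0 < t by apply: leq_ltn_trans (ltn_ord i).
have := congr1 (divn^~ t) e.
by rewrite !divnMDl // !divn_small ?ltn_ord // !addn0.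
Qed.

(** * Sets on a disjoint union of three ground sets, and their traces *)

Section Join.

Context {X Y Z : finType}.

Definition join (P : {set X}) (A : {set Y}) (D : {set Z}) :
    {set X + (Y + Z)} :=
  [set u | match u with
           | inl x => x \in P
           | inr (inl y) => y \in A
           | inr (inr z) => z \in D
           end].

Definition trX (S : {set X + (Y + Z)}) : {set X} := inl @^-1: S.
Definition trY (S : {set X + (Y + Z)}) : {set Y} := (inr \o inl) @^-1: S.
Definition trZ (S : {set X + (Y + Z)}) : {set Z} := (inr \o inr) @^-1: S.

Lemma trX_join P A D : trX (join P A D) = P.
Proof. by apply/setP=> x; rewrite !inE. Qed.

Lemma trY_join P A D : trY (join P A D) = A.
Proof. by apply/setP=> x; rewrite !inE. Qed.

Lemma trZ_join P A D : trZ (join P A D) = D.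
Proof. by apply/setP=> x; rewrite !inE. Qed.

Lemma trX_setI S S' : trX (S :&: S') = trX S :&: trX S'.
Proof. exact: preimsetI. Qed.

Lemma trY_setI S S' : trY (S :&: S') = trY S :&: trY S'.
Proof. exact: preimsetI. Qed.

Lemma card_join P A D : #|join P A D| = #|P| + (#|A| + #|D|).
Proof.
rewrite -sum1_card !big_sumType /= -!sum1_card.
by congr (_ + (_ + _)); apply: eq_bigl => x; rewrite !inE.
Qed.

End Join.

(** * The family: size, matchings and sunflowers, with [n] standing for [k - 1] *)

Section Construction.

Context {Y Z : finType} {n q : nat}.
Variables (B : 'I_q -> {set 'I_n}) (H : {set {set Y}}) (E : {set {set Z}}).
Variables (k m t w : nat).
Hypotheses (t2 : 2 <= t) (kn : k = n.+1) (mt : m + t = n + 2) (m2 : 2 <= m).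
Hypothesis tw : t < w.
Hypothesis cardB : forall j, #|B j| = t.
Hypothesis disjB : forall i j x, x \in B i -> x \in B j -> i = j.
Hypotheses (Hw : uniform (w - 1) H) (Hk : sunflower_free k H).
Hypothesis Hm : matching_number H <= m - 1.
Hypotheses (Ew : uniform (w - t) E) (Ek : sunflower_free k E).

Definition point_family : {set {set 'I_n + (Y + Z)}} :=
  [set join [set p.1] p.2 set0 | p in setX [set: 'I_n] H].
Definition block_family : {set {set 'I_n + (Y + Z)}} :=
  [set join (B p.1) set0 p.2 | p in setX [set: 'I_q] E].
Definition family := point_family :|: block_family.

Lemma point_familyP S : S \in point_family ->
  exists2 x, S = join [set x] (trY S) set0 & trY S \in H.
Proof.
by case/imsetP=> -[x A]; rewrite inE /= => /andP[_ AH] ->; exists x; rewrite trY_join.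
Qed.

Lemma block_familyP S : S \in block_family ->
  exists2 j, S = join (B j) set0 (trZ S) & trZ S \in E.
Proof.
by case/imsetP=> -[j D]; rewrite inE /= => /andP[_ DE] ->; exists j; rewrite trZ_join.
Qed.

Lemma card_trX_point S : S \in point_family -> #|trX S| = 1.
Proof. by case/point_familyP=> x -> _; rewrite trX_join cards1. Qed.

Lemma card_trX_block S : S \in block_family -> #|trX S| = t.
Proof. by case/block_familyP=> j -> _; rewrite trX_join. Qed.

Lemma card_trX_gt0 S : S \in family -> 0 < #|trX S|.
Proof.
by case/setUP=> [/card_trX_point|/card_trX_block] ->; lia.
Qed.

Lemma trX_point S x : S \in point_family -> x \in trX S -> trX S = [set x].
Proof.
by case/point_familyP=> y -> _; rewrite trX_join inE => /eqP->.
Qed.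

Lemma trX_block S S' x : S \in block_family -> S' \in block_family ->
  x \in trX S -> x \in trX S' -> trX S = trX S'.
Proof.
case/block_familyP=> j -> _ /block_familyP[j' -> _]; rewrite !trX_join.
by move=> xj /(disjB _ _ _ xj) ->.
Qed.

Lemma point_family_inj S S' : S \in point_family -> S' \in point_family ->
  trX S = trX S' -> trY S = trY S' -> S = S'.
Proof.
case/point_familyP=> x -> _ /point_familyP[x' -> _].
by rewrite !trX_join !trY_join => -> ->.
Qed.

Lemma block_family_inj S S' : S \in block_family -> S' \in block_family ->
  trX S = trX S' -> trZ S = trZ S' -> S = S'.
Proof.
case/block_familyP=> x -> _ /block_familyP[x' -> _].
by rewrite !trX_join !trZ_join => -> ->.
Qed.

Lemma card_family : #|family| = n * #|H| + q * #|E|.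
Proof.
rewrite cardsU; have -> : point_family :&: block_family = set0.
  apply/setP=> S; rewrite !inE; apply/negP=> /andP[/card_trX_point c1].
  by move/card_trX_block; lia.
rewrite cards0 subn0; congr (_ + _); rewrite card_in_imset ?cardsX ?cardsT ?card_ord //.
  move=> [x A] [x' A'] _ _ /= e.
  have /set1_inj -> : [set x] = [set x'] by have := congr1 trX e; rewrite !trX_join.
  by have := congr1 trY e; rewrite !trY_join => ->.
move=> [j D] [j' D'] _ _ /= e.
have eB : B j = B j' by have := congr1 trX e; rewrite !trX_join.
(* Blocks are nonempty, so equal blocks have equal indices. *)
have /card_gt0P[x xj] : 0 < #|B j| by rewrite cardB; lia.
have <- : j = j' by apply: (disjB _ _ x); rewrite -?eB.
by have := congr1 trZ e; rewrite !trZ_join => ->.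
Qed.

Lemma uniform_family : uniform w family.
Proof.
move=> S /setUP[/point_familyP[x -> SH]|/block_familyP[j -> SE]].
  by have := Hw _ SH; rewrite card_join trY_join cards1 cards0; lia.
by have := Ew _ SE; rewrite card_join trZ_join cardB cards0; lia.
Qed.

Lemma sum_trX (S : {set {set 'I_n + (Y + Z)}}) :
  {in S &, forall A A', A != A' -> trX (A :&: A') = set0} ->
  \sum_(A in S) #|trX A| <= n.
Proof.
move=> dS; have := sum_card_disjoint S trX; rewrite card_ord; apply.
move=> A A' AS AS' nA; by rewrite -setI_eq0 -trX_setI; apply/eqP/dS.
Qed.

(** The traces on [Y] are pairwise disjoint members of [H]. Only the trace of [C] on [Y] must
    vanish, so the lemma serves both matchings and sunflowers whose core lies off [Y]. *)
Lemma card_point_matching (S : {set {set 'I_n + (Y + Z)}}) C : S \subset point_family ->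
  {in S &, forall A A', A != A' -> A :&: A' = C} -> trY C = set0 ->
  #|S| <= m - 1.
Proof.
move=> /subsetP SP SC C0.
have inj : {in S &, injective (trY (X := 'I_n) (Y := Y) (Z := Z))}.
  move=> A A' AS AS' eA; apply/eqP/negP => /negP nA.
  have /point_familyP[_ _ /Hw] := SP _ AS.
  have : trY A :&: trY A' = set0 by rewrite -trY_setI (SC A A').
  (* Equal traces would be disjoint from themselves, hence empty, but [w - 1 > 0]. *)
  by rewrite -eA setIid => ->; rewrite cards0; lia.
rewrite -(card_in_imset inj); apply: leq_trans Hm; apply: card_matching.
  by apply/subsetP=> _ /imsetP[A /SP/point_familyP[_ _ AH] ->].
exact: trivIset_preim SC C0.
Qed.

Lemma matching_family : matching_number family <= m - 1.
Proof.
apply/bigmax_leqP=> S /andP[/subsetP SF /trivIsetP tS].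
have SC : {in S &, forall A A', A != A' -> A :&: A' = set0}.
  by move=> A A' AS AS' /(tS _ _ AS AS'); rewrite -setI_eq0 => /eqP.
have [SP|/subsetPn[A AS nA]] := boolP (S \subset point_family).
  by apply: card_point_matching SP SC _; apply: preimset0.
have AB : A \in block_family by have := SF _ AS; rewrite !inE (negbTE nA).
have : \sum_(A in S) #|trX A| <= n.
  by apply: sum_trX => A1 A2 *; rewrite SC //; apply: preimset0.
have : \sum_(A' in S :\ A) 1 <= \sum_(A' in S :\ A) #|trX A'|.
  by apply: leq_sum => A' /setD1P[_ /SF /card_trX_gt0].
rewrite sum1_card (big_setD1 _ AS) /= card_trX_block // (cardsD1 A S) AS.
(* Here [c] counts the members other than [A], each using a point outside the block of [A]; [mt]
   gives [n - t = m - 2]. *)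
have arith c : t + c <= n -> 1 + c <= m - 1 by lia.
by rewrite -(leq_add2l t) => /leq_trans le1 /le1 /arith.
Qed.

(** Otherwise [k] nonempty disjoint traces would fit into [k - 1] points. *)
Lemma core_meets_X (S : {set {set 'I_n + (Y + Z)}}) C : S \subset family -> #|S| = k ->
  {in S &, forall A A', A != A' -> A :&: A' = C} ->
  exists2 x, x \in trX C & {in S, forall A, x \in trX A}.
Proof.
move=> /subsetP SF cS SC.
have [C0|/set0Pn[x xC]] := eqVneq (trX C) set0.
  have : \sum_(A in S) #|trX A| <= n by apply: sum_trX => A A' *; rewrite (SC A A').
  have : \sum_(A in S) 1 <= \sum_(A in S) #|trX A|.
    by apply: leq_sum => A /SF /card_trX_gt0.
  by rewrite sum1_card cS; lia.
exists x => // A AS.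
have /card_gt0P[A'] : 0 < #|S :\ A| by move: cS; rewrite (cardsD1 A S) AS; lia.
case/setD1P=> nA A'S; move: xC; rewrite -(SC A A') 1?eq_sym // trX_setI.
by case/setIP.
Qed.

(** All traces on the points are the singleton of [x], so petals are told apart by their traces on
    [Y]. *)
Lemma no_point_sunflower (S : {set {set 'I_n + (Y + Z)}}) x :
  S \subset point_family -> is_sunflower k S ->
  ~ {in S, forall A, x \in trX A}.
Proof.
move=> /subsetP SP sS Sx; apply: (Hk [set trY A | A in S]).
  by apply/subsetP=> _ /imsetP[A /SP/point_familyP[_ _ AH] ->].
apply: sunflower_preim sS => A A' AS AS' eA; apply: point_family_inj eA; try exact: SP.
rewrite (trX_point A x (SP _ AS) (Sx _ AS)).
by rewrite (trX_point A' x (SP _ AS') (Sx _ AS')).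
Qed.

Lemma no_block_sunflower (S : {set {set 'I_n + (Y + Z)}}) x :
  S \subset block_family -> is_sunflower k S ->
  ~ {in S, forall A, x \in trX A}.
Proof.
move=> /subsetP SB sS Sx; apply: (Ek [set trZ A | A in S]).
  by apply/subsetP=> _ /imsetP[A /SB/block_familyP[_ _ AE] ->].
apply: sunflower_preim sS => A A' AS AS' eA; apply: block_family_inj eA; try exact: SB.
by apply: (trX_block _ _ x); auto.
Qed.

Lemma sunflower_free_family : sunflower_free k family.
Proof.
(* Since [t >= 2], [m - 1 < k - 1]; [true] is the membership term produced by [cardsD1]. *)
have arith c : c <= m - 1 -> true + c <> k by lia.
move=> S SF sS; have [cS [C SC]] := sS.
have [x xC xS] := core_meets_X _ _ SF cS SC.
have [SP|/subsetPn[A AS nAP]] := boolP (S \subset point_family).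
  exact: no_point_sunflower SP sS xS.
have [SB|/subsetPn[P PS nPB]] := boolP (S \subset block_family).
  exact: no_block_sunflower SB sS xS.
have AB : A \in block_family.
  by have /setUP[] := subsetP SF _ AS; rewrite ?(negbTE nAP).
have PP : P \in point_family.
  by have /setUP[] := subsetP SF _ PS; rewrite ?(negbTE nPB).
have nAP' : A != P by apply: contraNneq nAP => ->.
have C_P : trX C \subset trX P.
  by rewrite -(SC _ _ AS PS nAP') trX_setI subsetIr.
(* A second petal of type 2 through [x] would have the same block as [A], putting [t >= 2] points
   into the core, whose trace lies in the single point of [P]. *)
have S'P : S :\ A \subset point_family.
  apply/subsetP=> A' /setD1P[nA A'S].
  have /setUP[//|A'B] := subsetP SF _ A'S.
  have eX : trX A' = trX A by apply: (trX_block _ _ x); auto.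
  have := subset_leq_card C_P.
  rewrite -(SC _ _ A'S AS nA) trX_setI eX setIid.
  by rewrite (card_trX_block _ AB) (card_trX_point _ PP) leqNgt t2.
suff /arith : #|S :\ A| <= m - 1 by move: cS; rewrite (cardsD1 A S) AS.
apply: (card_point_matching _ C) => //.
  by move=> A1 A2 /setD1P[_ A1S] /setD1P[_ A2S]; apply: SC.
(* The core lies in [A], which has no point in [Y]. *)
rewrite -(SC _ _ AS PS nAP') trY_setI.
by case/block_familyP: AB => j -> _; rewrite trY_join set0I.
Qed.

End Construction.

Theorem theorem3p1 (k m w : nat) :
  3 <= k -> 2 <= m <= k - 1 ->
  let t := k - m + 1 in
  t + 1 <= w ->
  psi w k m >= (k - 1) * psi (w - 1) k m + ((k - 1) %/ t) * f (w - t) k.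
Proof.
move=> k3 /andP[m2 mk] t tw; have k2 : 2 <= k by lia.
have [[Y [H [Hw Hk Hm <-]]] _] := @psi_spec (w - 1) k m k2.
have [[Z [E [Ew Ek <-]]] _] := @f_spec (w - t) k k2.
have [B [cardB disjB]] := disjoint_blocks _ _ _ (leq_trunc_div (k - 1) t).
apply: (proj2 (@psi_spec w k m k2)).
exists ('I_(k - 1) + (Y + Z))%type, (family B H E).
(* This is where [m <= k - 1] enters. *)
have t2 : 2 <= t by lia.
have kn : k = (k - 1).+1 by lia.
have mt : m + t = k - 1 + 2 by lia.
have tw' : t < w by lia.
split.
- exact: (uniform_family B H E k m t w).
- exact: (sunflower_free_family B H E k m t w).
- exact: (matching_family B H E k m t w).
- exact: (card_family B H E k m t w).
Qed.
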